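(* Let $t$ be a positive integer. If $G$ is an induced-subgraph-minimal graph having a pivot-minor isomorphic to $P_2+tP_1$, then $|V(G)|\le (t+1)(2^{t+2}-t-2)$.
   Context: Graphs are finite, without loops or multiple edges. $P_2+tP_1$ is the disjoint union of one edge and $t$ isolated vertices. For a vertex $u$ of a graph $G$, the local complementation $G*u$ is obtained from $G$ by complementing the adjacency between every pair of distinct neighbours of $u$. For an edge $uv$ of $G$, the edge pivot is $G\wedge uv=((G*u)*v)*u$. A graph $G$ contains $H$ as a pivot-minor if $H$ can be obtained from $G$ by a sequence of vertex deletions and edge pivots. A graph $G$ is an induced-subgraph-minimal graph having a pivot-minor isomorphic to $H$ if $G$ has a pivot-minor isomorphic to $H$ but no proper induced subgraph of $G$ does. *)

(* Defs.v *)
From HB Require Import structures.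
From mathcomp Require Import all_boot.

Set Implicit Arguments.
Unset Strict Implicit.
Unset Printing Implicit Defensive.

Record sgraph := SGraph {
  vert :> finType;
  adj : rel vert;
  adj_sym : symmetric adj;
  adj_irrefl : irreflexive adj }.

Definition giso (G H : sgraph) : Prop :=
  exists2 f : G -> H, bijective f & forall x y, adj (f x) (f y) = adj x y.

Section Operations.
Variable G : sgraph.

Definition induced_adj (A : {set G}) : rel {x : G | x \in A} :=
  fun x y => adj (val x) (val y).

Lemma induced_sym (A : {set G}) : symmetric (@induced_adj A).
Proof. by move=> x y; apply: adj_sym. Qed.

Lemma induced_irrefl (A : {set G}) : irreflexive (@induced_adj A).
Proof. by move=> x; apply: adj_irrefl. Qed.

Definition induced (A : {set G}) : sgraph :=
  SGraph (@induced_sym A) (@induced_irrefl A).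

Definition del_vertex (v : G) : sgraph := induced [set~ v].

Definition local_compl_adj (u : G) : rel G :=
  fun x y => adj x y (+) [&& x != y, adj u x & adj u y].

Lemma local_compl_sym (u : G) : symmetric (local_compl_adj u).
Proof.
by move=> x y; rewrite /local_compl_adj adj_sym eq_sym (andbC (adj u x)).
Qed.

Lemma local_compl_irrefl (u : G) : irreflexive (local_compl_adj u).
Proof. by move=> x; rewrite /local_compl_adj adj_irrefl eqxx. Qed.

Definition local_compl (u : G) : sgraph :=
  SGraph (local_compl_sym u) (local_compl_irrefl u).

End Operations.

(* Local complementation keeps the vertex type, so [u] and [v] remain vertices. *)
Definition pivot (G : sgraph) (u v : G) : sgraph :=
  @local_compl (@local_compl (@local_compl G u) v) u.

(* [pivot_minor G H]: H is literally obtained from G (no isomorphism). *)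
Inductive pivot_minor : sgraph -> sgraph -> Prop :=
| pm_refl (G : sgraph) : pivot_minor G G
| pm_del (G H : sgraph) (v : G) : pivot_minor (del_vertex v) H -> pivot_minor G H
| pm_pivot (G H : sgraph) (u v : G) :
    adj u v -> pivot_minor (pivot u v) H -> pivot_minor G H.

Definition has_pivot_minor (G H : sgraph) : Prop :=
  exists2 K, pivot_minor G K & giso K H.

Definition minimal_with_pivot_minor (G H : sgraph) : Prop :=
  has_pivot_minor G H /\
  forall A : {set G}, A \proper [set: G] -> ~ has_pivot_minor (induced A) H.

Section DisjointUnion.
Variables G H : sgraph.

Definition disjoint_union_adj : rel (G + H)%type := fun x y =>
  match x, y with
  | inl a, inl b => adj a b
  | inr a, inr b => adj a b
  | _, _ => false
  end.

Lemma disjoint_union_sym : symmetric disjoint_union_adj.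
Proof. by move=> [a|a] [b|b] //=; apply: adj_sym. Qed.

Lemma disjoint_union_irrefl : irreflexive disjoint_union_adj.
Proof. by move=> [a|a] /=; apply: adj_irrefl. Qed.

Definition disjoint_union : sgraph :=
  SGraph disjoint_union_sym disjoint_union_irrefl.

End DisjointUnion.

Definition path_adj (n : nat) : rel 'I_n :=
  fun i j => (i.+1 == j :> nat) || (j.+1 == i :> nat).

Lemma path_sym n : symmetric (@path_adj n).
Proof. by move=> i j; rewrite /path_adj orbC. Qed.

Lemma path_irrefl n : irreflexive (@path_adj n).
Proof. by move=> i; rewrite /path_adj orbb (gtn_eqF (ltnSn i)). Qed.

Definition path_graph (n : nat) : sgraph :=
  SGraph (@path_sym n) (@path_irrefl n).

Definition edgeless_adj (n : nat) : rel 'I_n := fun _ _ => false.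

Lemma edgeless_sym n : symmetric (@edgeless_adj n).
Proof. by []. Qed.

Lemma edgeless_irrefl n : irreflexive (@edgeless_adj n).
Proof. by []. Qed.

Definition edgeless (n : nat) : sgraph :=
  SGraph (@edgeless_sym n) (@edgeless_irrefl n).

Definition P2_tP1 (t : nat) : sgraph :=
  disjoint_union (path_graph 2) (edgeless t).

(* Main.v *)
(* Write [N] for the adjacency relation made reflexive. Pivoting on [uv] is then
   N'(p,q) = N(p,q) + N(u,p) N(v,q) + N(u,q) N(v,p) over GF(2), with no exception
   at [u] and [v].

   Let [M] be pivot-equivalent to the minimal graph [G] and contain the target on
   [T] = {a, b} + C. For a vertex [v], deleting [v] from [G] amounts, up to pivots,
   either to deleting it from [M] or to contracting it, i.e. deleting it after a
   pivot on an edge at [v]; moreover two nonadjacent twins of [M] are not both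
   contracted. By minimality each vertex outside [T] is contracted, it has a
   neighbour, and contracting it in [M] destroys every copy of the target.

   Sort the vertices outside [T] by their neighbourhood in [T]. A class is
   independent, since pivoting on an edge inside it fixes the graph on [T]. If its
   type contains some c in C, pivoting on an edge yc makes the rest of the class,
   together with ab, a target, so the class has at most t vertices. The types
   empty and {a, b} do not occur. A class of type {a} has at most 2t - 1 vertices:
   either some member y0 has a neighbour z other than a, and then both the
   neighbours and the nonneighbours of z in the class are few, or all members are
   pendant at a and are twins. *)

Require Import Defs.
From mathcomp Require Import all_boot zify.

Set Implicit Arguments.
Unset Strict Implicit.
Unset Printing Implicit Defensive.

Notation nrel V := {ffun V -> {ffun V -> bool}}.

(** * Pivots of reflexive symmetric relations *)

Section Pivoting.
Variable V : finType.
Implicit Types (N M K : nrel V) (S T C : {set V}) (a b c p q u v w x y z : V).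

Definition piv N u v : nrel V :=
  [ffun p => [ffun q => N p q (+) (N u p && N v q) (+) (N u q && N v p)]].

Definition closed_nbr N := (forall p, N p p) /\ (forall p q, N p q = N q p).

Lemma pivE N u v p q :
  piv N u v p q = N p q (+) (N u p && N v q) (+) (N u q && N v p).
Proof. by rewrite !ffunE. Qed.

Lemma closed_nbr_piv N u v : closed_nbr N -> closed_nbr (piv N u v).
Proof.
move=> [r s]; split=> [p|p q]; rewrite !pivE ?r ?(s q p); first by case: andP.
by rewrite -!addbA; congr (_ (+) _); rewrite addbC.
Qed.

Lemma pivC N u v : piv N u v = piv N v u.
Proof.
apply/ffunP=> p; apply/ffunP=> q; rewrite !pivE -!addbA; congr (_ (+) _).
by rewrite addbC andbC (andbC (N u p)).
Qed.

Lemma pivK N u v : closed_nbr N -> N u v -> piv (piv N u v) u v = N.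
Proof.
move=> [r s] uv; apply/ffunP=> p; apply/ffunP=> q.
rewrite !pivE ?r (s v u) uv.
by case: (N p q); case: (N u p); case: (N v p); case: (N u q); case: (N v q).
Qed.

Lemma piv_end N u v p : closed_nbr N -> N u v -> piv N u v v p = N u p.
Proof.
by move=> [r s] uv; rewrite !pivE ?r uv; case: (N v p); case: (N u p).
Qed.

(** The first pivot interchanges the closed neighbourhoods of [x] and [y], so the edge [x v]
    reappears as [y v]. *)
Lemma piv_tri N x y v :
  closed_nbr N -> N x y -> N x v -> piv (piv N x y) y v = piv N x v.
Proof.
move=> [r s] xy xv; apply/ffunP=> p; apply/ffunP=> q.
rewrite !pivE ?r xy xv ?(s v y).
by case: (N p q); case: (N x p); case: (N v p); case: (N x q); case: (N v q);
  case: (N y p); case: (N y q); case: (N y v).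
Qed.

(** The nonadjacencies keep each of the two edges in place when the other is pivoted. *)
Lemma piv_commute N x y v w :
  closed_nbr N -> N x y -> N v w -> ~~ N v x -> ~~ N v y ->
  piv (piv N x y) v w = piv (piv N v w) x y.
Proof.
move=> [r s] xy vw /negPf vx /negPf vy; apply/ffunP=> p; apply/ffunP=> q.
rewrite !pivE ?r ?xy ?vw ?(s x v) ?(s y v) vx vy ?(s w x) ?(s w y) /=.
by case: (N p q); case: (N x p); case: (N v p); case: (N x q); case: (N v q);
  case: (N y p); case: (N y q); case: (N w p); case: (N w q);
  case: (N x w); case: (N y w).
Qed.

(** Deletion is modelled by confining pivots to [S]: on [S] they act as if the other vertices were
    absent, and the vertex type stays fixed. *)
Inductive reach S N : nrel V -> Prop :=
| reach_refl : reach S N N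
| reach_step M u v : reach S N M -> u \in S -> v \in S -> u != v -> M u v ->
    reach S N (piv M u v).

Lemma reach_cons S N M u v :
  u \in S -> v \in S -> u != v -> N u v -> reach S (piv N u v) M -> reach S N M.
Proof.
move=> uS vS uv Nuv; elim=> [|K x y _ IH xS yS xy Kxy]; last exact: reach_step.
by apply: reach_step=> //; apply: reach_refl.
Qed.

Lemma reach_sub S S' N M : S \subset S' -> reach S N M -> reach S' N M.
Proof.
move=> /subsetP sS; elim=> [|K x y _ IH xS yS xy Kxy]; first exact: reach_refl.
by apply: reach_step; rewrite ?sS.
Qed.

Lemma closed_nbr_reach S N M : closed_nbr N -> reach S N M -> closed_nbr M.
Proof. by move=> cN; elim=> // K x y _ cK *; apply: closed_nbr_piv. Qed.

Variable t : nat.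

(* As [N] is reflexive, the conditions force [a] and [b] to lie outside [C]. *)
Definition good N a b C :=
  [/\ (a != b) && N a b, t <= #|C|,
      forall c, c \in C -> ~~ N a c /\ ~~ N b c &
      forall c d, c \in C -> d \in C -> c != d -> ~~ N c d].

Definition has_target S N := exists M a b C,
  [/\ reach S N M, good M a b C, a \in S, b \in S & C \subset S].

Lemma has_target_sub S S' N : S \subset S' -> has_target S N -> has_target S' N.
Proof.
move=> sS [M [a [b [C [r g aS bS CS]]]]]; exists M, a, b, C.
split=> //; [exact: reach_sub r | exact: (subsetP sS) | exact: (subsetP sS) |].
exact: subset_trans sS.
Qed.

Lemma has_target_piv S N u v : u \in S -> v \in S -> u != v -> N u v ->
  has_target S (piv N u v) -> has_target S N.
Proof.
move=> uS vS uv Nuv [M [a [b [C [r g aS bS CS]]]]]; exists M, a, b, C.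
by split=> //; apply: reach_cons r.
Qed.

Lemma has_target_good N v a b C :
  good N a b C -> v != a -> v != b -> v \notin C -> has_target [set~ v] N.
Proof.
move=> g va vb vC; exists N, a, b, C; split=> //; first exact: reach_refl.
- by rewrite !inE eq_sym.
- by rewrite !inE eq_sym.
- by apply/subsetP=> c cC; rewrite !inE; apply: contraNneq vC => <-.
Qed.

(** * Deletion, contraction and twins along a sequence of pivots *)

Section Deletion.
Variables (N : nrel V) (v : V).

Definition pulls_back M := has_target [set~ v] M -> has_target [set~ v] N.

Definition contracted M :=
  (exists2 w, w != v & M v w) /\
  forall w, w != v -> M v w -> pulls_back (piv M v w).

Lemma pulls_back_piv M x y : x != v -> y != v -> x != y -> M x y ->
  pulls_back M -> pulls_back (piv M x y).
Proof.
move=> xv yv xy Mxy P H; apply: P.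
by apply: has_target_piv H; rewrite ?inE.
Qed.

(* Contracting [v] along different neighbours gives pivot-equivalent graphs. *)
Lemma contractedI M w : closed_nbr M -> w != v -> M v w ->
  pulls_back (piv M v w) -> contracted M.
Proof.
move=> cM wv vw P; split=> [|w' w'v vw']; first by exists w.
have [<- //|ww'] := eqVneq w w'.
rewrite -(piv_tri cM vw vw'); apply: pulls_back_piv => //.
by rewrite (piv_end _ cM vw).
Qed.

Lemma pulls_back_contracted M y : closed_nbr M -> y != v -> M v y ->
  pulls_back M -> contracted (piv M v y).
Proof.
move=> cM yv vy P; apply: (@contractedI _ y) => //.
- exact: closed_nbr_piv.
- by rewrite pivC piv_end // ?cM.1 //; rewrite cM.2.
- by rewrite pivK.
Qed.

(** If [x] is adjacent to [v], contracting [v] along [y] after the pivot agrees with contracting it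
    along [x] before ([piv_tri]); the case of [y] is symmetric. Otherwise the two pivots commute. *)
Lemma contracted_piv M x y : closed_nbr M -> x != v -> y != v -> x != y ->
  M x y -> contracted M -> contracted (piv M x y).
Proof.
move=> cM xv yv xy Mxy [[w wv vw] P]; have cM' := closed_nbr_piv x y cM.
have nbr_end x' y' : x' != v -> y' != v -> M x' y' -> M v x' ->
    contracted (piv M x' y').
  move=> x'v y'v x'y' vx'; have x'v' : M x' v by rewrite cM.2.
  apply: (@contractedI _ y') => //; first exact: closed_nbr_piv.
    by rewrite (closed_nbr_piv x' y' cM).2 piv_end.
  by rewrite pivC piv_tri // pivC; apply: P.
have [vx|vx] := boolP (M v x); first exact: nbr_end.
have [vy|vy] := boolP (M v y).
  by rewrite pivC; apply: nbr_end; rewrite // cM.2.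
apply: (@contractedI _ w) => //.
  by rewrite pivE (cM.2 x v) (cM.2 y v) (negPf vx) (negPf vy) vw andbF.
rewrite piv_commute //; apply: pulls_back_piv => //; last exact: P.
by rewrite pivE (negPf vx) (negPf vy) Mxy.
Qed.

End Deletion.

(* The vector [s e_y + s' e_y'] is mapped by the open adjacency matrix to the
   complementary vector on [y, y'], so swapping coordinates preserves this. *)
Definition linked N y y' s s' :=
  forall p, (s && N y p) (+) (s' && N y' p) = (p == y) (+) (p == y').

Lemma linked_piv_disjoint N y y' s s' u v : closed_nbr N -> y != y' ->
  u != y -> u != y' -> v != y -> v != y' ->
  linked N y y' s s' -> linked (piv N u v) y y' s s'.
Proof.
move=> cN yy' /negPf uy /negPf uy' /negPf vy /negPf vy' L p.
rewrite !pivE -(L p) !(cN.2 _ y) !(cN.2 _ y').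
have := L u; have := L v; rewrite uy uy' vy vy'.
by case: s L; case: s' => _ /=; case: (N y u); case: (N y' u); case: (N y v);
  case: (N y' v) => //= _ _; case: (N y p); case: (N y' p); case: (N u p);
  case: (N v p).
Qed.

Lemma linked_piv_one N y y' s s' v : closed_nbr N -> y != y' ->
  v != y -> v != y' -> N y v ->
  linked N y y' s s' -> linked (piv N y v) y y' (~~ s) s'.
Proof.
move=> cN yy' /negPf vy /negPf vy' yv L p.
rewrite !pivE -(L p) ?cN.1 (cN.2 v y) yv (cN.2 v y').
have := L v; have := L y; have := L y'.
rewrite vy vy' !eqxx (eq_sym y' y) (negPf yy') !cN.1 (cN.2 y' y) yv.
by case: s L; case: s' => _ /=; case: (N y y'); case: (N y' v) => //= _ _ _;
  case: (N y p); case: (N y' p); case: (N v p).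
Qed.

Lemma linked_piv_both N y y' s s' : closed_nbr N -> y != y' -> N y y' ->
  linked N y y' s s' -> linked (piv N y y') y y' (~~ s) (~~ s').
Proof.
move=> cN yy' e L p.
rewrite !pivE -(L p) ?cN.1 (cN.2 y' y) e.
have := L y; rewrite !eqxx (negPf yy') !cN.1 (cN.2 y' y) e.
by case: s L; case: s' => _ //= _; case: (N y p); case: (N y' p).
Qed.

Lemma linkedC N y y' s s' : linked N y y' s s' -> linked N y' y s' s.
Proof. by move=> L p; rewrite addbC L addbC. Qed.

(** At a pivoted coordinate the vector and its image trade entries. These are complementary at [y]
    and [y'] and both zero elsewhere, so only the flags of pivoted vertices flip. *)
Lemma linked_piv N y y' s s' u v : closed_nbr N -> y != y' -> u != v -> N u v ->
  linked N y y' s s' ->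
  linked (piv N u v) y y' (s (+) (y \in [:: u; v])) (s' (+) (y' \in [:: u; v])).
Proof.
move=> cN yy' uv Nuv L; rewrite !inE !(eq_sym _ u) !(eq_sym _ v).
have Nvu : N v u by rewrite cN.2.
case: (eqVneq u y) (eqVneq u y') (eqVneq v y) (eqVneq v y')
  => [uy|uy] [uy'|uy'] [vy|vy] [vy'|vy']; subst;
  rewrite ?eqxx // in uv yy' *; rewrite /= ?addbT ?addbF.
- exact: linked_piv_both.
- exact: linked_piv_one.
- by rewrite pivC; apply: linked_piv_both.
- by apply: linkedC; apply: linked_piv_one; rewrite ?(eq_sym y') //; apply: linkedC.
- by rewrite pivC; apply: linked_piv_one.
- rewrite pivC; apply: linkedC; apply: linked_piv_one; rewrite ?(eq_sym y') //.
  exact: linkedC.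
- exact: linked_piv_disjoint.
Qed.

(* [s v] tells whether [M] arises from [N] by a principal pivot avoiding [v]. *)
Lemma reach_states N M : closed_nbr N -> reach [set: V] N M ->
  exists s : V -> bool,
    (forall v, if s v then pulls_back N v M else contracted N v M) /\
    forall y y', y != y' -> ~ linked M y y' (~~ s y) (~~ s y').
Proof.
move=> cN; elim=> [|K u v r [s [IH1 IH2]] _ _ uv Kuv].
  (* Both flags start as false, so a link would equate the zero vector with a nonzero one. *)
  exists (fun=> true); split=> [v H //|y y' yy' /(_ y) /=].
  by rewrite eqxx (negPf yy').
have cK := closed_nbr_reach cN r.
(* Deletion and contraction trade places at the two ends of the pivot and nowhere else. *)
exists (fun x => s x (+) (x \in [:: u; v])); split=> [x|y y' yy' L].
  have step x' y' : K x' y' -> x' != y' ->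
      if s x' then contracted N x' (piv K x' y') else pulls_back N x' (piv K x' y').
    move=> Kxy xy; have yx : y' != x' by rewrite eq_sym.
    case: (s x') (IH1 x') => [P|[_ P]]; first exact: pulls_back_contracted.
    exact: P.
  rewrite !inE; have [->|xu] := eqVneq x u.
    by rewrite addbT; case: (s u) (step u v Kuv uv).
  have [->|xv] := eqVneq x v.
    rewrite addbT pivC; have vu : v != u by rewrite eq_sym.
    have Kvu : K v u by rewrite cK.2.
    by case: (s v) (step v u Kvu vu).
  rewrite addbF; move: xu xv; rewrite !(eq_sym x) => ux vx.
  by case: (s x) (IH1 x) => P; [apply: pulls_back_piv | apply: contracted_piv].
(* Repeating the pivot carries the link back to [K] and restores the flags. *)
apply: (IH2 y y' yy').
have cK' := closed_nbr_piv u v cK.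
have K'uv : piv K u v u v by rewrite cK'.2 piv_end // cK.1.
have := linked_piv cK' yy' uv K'uv L; rewrite pivK //.
by case: (y \in _); case: (y' \in _); rewrite !(addbT, addbF) ?negbK.
Qed.

End Pivoting.


(** * Translation between graphs and relations *)

Section Graphs.
Implicit Types G H K : sgraph.

Definition nbr G : nrel G := [ffun x => [ffun y => (x == y) || adj x y]].

Lemma nbrE G (x y : G) : nbr G x y = (x == y) || adj x y.
Proof. by rewrite !ffunE. Qed.

Lemma closed_nbr_nbr G : closed_nbr (nbr G).
Proof. by split=> [p|p q]; rewrite !nbrE ?eqxx // eq_sym adj_sym. Qed.

Lemma nbr_pivot G (u v : G) : adj u v -> nbr (pivot u v) = piv (nbr G) u v.
Proof.
move=> uv; have vu : adj v u by rewrite adj_sym.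
have neq : u != v by apply: contraTneq uv => ->; rewrite adj_irrefl.
apply/ffunP=> p; apply/ffunP=> q; rewrite pivE nbrE.
do 3!rewrite /= /local_compl_adj /=; rewrite !nbrE !adj_irrefl uv vu !(eq_sym v u) (negPf neq) /=.
have [<-|pq] := eqVneq p q.
  by case: (u == p); case: (v == p); case: (adj u p); case: (adj v p).
move: pq; rewrite !(adj_sym u) !(adj_sym v); move: p q => /= p q.
have vu' : (v == u) = false by rewrite eq_sym (negPf neq).
case: (eqVneq u p) => [<-|/negPf up]; [|case: (eqVneq v p) => [<-|/negPf vp]];
(case: (eqVneq u q) => [<-|/negPf uq]; [|case: (eqVneq v q) => [<-|/negPf vq]]);
rewrite ?eqxx ?adj_irrefl ?uv ?vu ?(negPf neq) ?vu' ?(adj_sym q) //= => pq;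
by case: (adj p q); case: (adj p u); case: (adj p v); case: (adj u q); case: (adj v q).
Qed.

(** Vertices outside the image of [f] are deleted one at a time; once [f] is onto, it is an
    isomorphism. *)
Lemma has_pivot_minor_embed G H (f : H -> G) : injective f ->
  (forall x y, adj (f x) (f y) = adj x y) -> has_pivot_minor G H.
Proof.
have [n] := ubnP #|G|; elim: n G f => // n IH G f leGn inj_f adj_f.
have [/forallP f_onto|] := boolP [forall v, v \in codom f].
  exists G; first exact: pm_refl.
  exists (fun v => iinv (f_onto v)); last first.
    by move=> x y; rewrite -adj_f !f_iinv.
  by exists f => x; [rewrite f_iinv | apply: inj_f; rewrite f_iinv].
rewrite negb_forall => /existsP[v vf].
have fv x : f x \in [set~ v].
  by rewrite !inE; apply: contraNneq vf => <-; apply: codom_f.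
have [|||K vK KH] := IH (del_vertex v) (fun x => exist _ (f x) (fv x)).
- rewrite card_sig cardsC1; have : 0 < #|G| by apply/card_gt0P; exists v.
  by move: leGn; case: #|G|.
- by move=> x y [/inj_f].
- by move=> x y; rewrite -adj_f.
by exists K => //; apply: pm_del vK.
Qed.

Lemma pivot_minor_trans G H K : pivot_minor G H -> pivot_minor H K -> pivot_minor G K.
Proof.
elim=> // [{}G {}H v _ IH HK|{}G {}H u v uv _ IH HK].
  by apply: pm_del (IH HK).
by apply: pm_pivot uv (IH HK).
Qed.

Lemma adj_nbr G (x y : G) : adj x y = (x != y) && nbr G x y.
Proof. by rewrite nbrE; have [->|] := eqVneq; rewrite ?adj_irrefl. Qed.

Lemma reach_pivot_minor G (A : {set G}) M : reach A (nbr G) M ->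
  exists2 K, pivot_minor (induced A) K &
    exists f : K -> G, [/\ injective f, forall x, x \in A <-> exists y, x = f y &
      forall x y, nbr K x y = M (f x) (f y)].
Proof.
elim=> [|{}M u v _ [K AK [f [inj_f imf Mf]]] uA vA uv Muv].
  exists (induced A); first exact: pm_refl.
  exists val; split=> [|x|x y]; first exact: val_inj.
    by split=> [xA|[y ->]]; [exists (exist _ x xA) | apply: (valP y)].
  by rewrite !nbrE.
have [[u' uE] [v' vE]] := (iffLR (imf u) uA, iffLR (imf v) vA); subst u v.
have uv' : adj u' v' by rewrite adj_nbr Mf Muv andbT (contra_neq _ uv) // => ->.
exists (pivot u' v').
  by apply: pivot_minor_trans AK (pm_pivot uv' (pm_refl _)).
by exists f; split=> // x y; rewrite nbr_pivot // !pivE !Mf.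
Qed.

Variable t : nat.

Lemma has_target_pivot_minor G (A : {set G}) :
  has_target t A (nbr G) -> has_pivot_minor (induced A) (P2_tP1 t).
Proof.
move=> [M [a [b [C [r g aA bA CA]]]]].
have [rM sM] := closed_nbr_reach (closed_nbr_nbr G) r.
have [K AK [f [inj_f imf Mf]]] := reach_pivot_minor r.
case: g => /andP[ab Mab] leC abC CC.
(* [C] may exceed [t] vertices; the first [t] in its enumeration serve as the isolated ones. *)
pose h (x : P2_tP1 t) : G := match x with
  | inl i => if i == 0 :> nat then a else b
  | inr j => enum_val (widen_ord leC j) end.
have hC j : h (inr j) \in C by apply: enum_valP.
have hA x : h x \in A.
  by case: x => [i|j] /=; [case: ifP | apply: (subsetP CA); apply: enum_valP].
have neqC c : c \in C -> (a != c) /\ (b != c).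
  by move=> /abC[ac bc]; split; [apply: contraNneq ac => -> | apply: contraNneq bc => ->].
have inj_h : injective h.
  move=> [i|j] [i'|j'].
  - move=> /= E; congr inl; apply: val_inj => /=.
    case: i i' E => -[|[|//]] ? [] [|[|//]] ? //= E; by rewrite E eqxx in ab.
  - move=> /= E; have [] := neqC _ (hC j'); rewrite /= -E.
    by case: ifP => _; rewrite eqxx.
  - move=> /= E; have [] := neqC _ (hC j); rewrite /= E.
    by case: ifP => _; rewrite eqxx.
  - by move=> /enum_val_inj [E]; congr inr; apply: val_inj.
have adj_h x y : adj x y = (x != y) && M (h x) (h y).
  case: x y => [i|j] [i'|j'].
  - by case: i i' => -[|[|//]] ? [] [|[|//]] ?; rewrite /= /path_adj /= ?eqxx // ?(sM b) Mab.
  - have [ac bc] := abC _ (hC j'); apply/esym/negP => /andP[_] /=.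
    by case: ifP => _; apply/negP.
  - have [ac bc] := abC _ (hC j); apply/esym/negP => /andP[_] /=; rewrite sM.
    by case: ifP => _; apply/negP.
  - apply/esym/negP => /andP[jj]; apply/negP; apply: CC => //.
    by apply: contra_neq jj => /inj_h.
have fh x : {y | f y = h x}.
  by apply: sig_eqW; have [y ->] := iffLR (imf _) (hA x); exists y.
have inj_k : injective (fun x => sval (fh x)).
  by move=> x y E; apply: inj_h; rewrite -(svalP (fh x)) -(svalP (fh y)) E.
have [|L KL LH] := has_pivot_minor_embed inj_k.
  move=> x y; rewrite adj_nbr Mf !(svalP (fh _)) adj_h; congr (~~ _ && _).
  by apply/eqP/eqP => [/inj_k|->].
by exists L => //; apply: pivot_minor_trans KL.
Qed.

Lemma reach_image (V W : finType) (f : W -> V) (S : {set W}) (N M : nrel W) (N' : nrel V) :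
  injective f -> (forall x y, N x y = N' (f x) (f y)) -> reach S N M ->
  exists2 M' : nrel V, reach (f @: S) N' M' & forall x y, M x y = M' (f x) (f y).
Proof.
move=> inj_f NN; elim=> [|{}M u v _ [M' r MM] uS vS uv Muv].
  by exists N' => //; apply: reach_refl.
exists (piv M' (f u) (f v)); last by move=> x y; rewrite !pivE !MM.
by apply: reach_step; rewrite ?imset_f ?inj_eq // -MM.
Qed.

Lemma has_target_image (V W : finType) (f : W -> V) (S : {set W}) (N : nrel W) (N' : nrel V) :
  injective f -> (forall x y, N x y = N' (f x) (f y)) ->
  has_target t S N -> has_target t (f @: S) N'.
Proof.
move=> inj_f NN [M [a [b [C [r [/andP[ab Mab] leC abC CC] aS bS CS]]]]].
have [M' r' MM] := reach_image inj_f NN r.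
exists M', (f a), (f b), (f @: C); split; rewrite ?imset_f ?imsetS //.
split; rewrite ?card_imset ?inj_eq // -?MM ?ab ?Mab //.
  by move=> _ /imsetP[c /abC[ac bc] ->]; rewrite -!MM.
move=> _ _ /imsetP[c cC ->] /imsetP[d dC ->]; rewrite inj_eq // -MM.
exact: CC.
Qed.

(** Deletions can wait: a pivot made after one is a pivot of the whole graph that avoids the deleted
    vertex. *)
Lemma pivot_minor_has_target G :
  has_pivot_minor G (P2_tP1 t) -> has_target t [set: G] (nbr G).
Proof.
case=> K; elim=> {G K} [G|G K v _ IH|G K u v uv _ IH] isoK.
- case: isoK => f [g fK gK] adj_f; have inj_g := can_inj gK.
  have nbr_g x y : nbr G (g x) (g y) = (x == y) || adj x y.
    by rewrite nbrE inj_eq // -adj_f !gK.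
  exists (nbr G), (g (inl ord0)), (g (inl ord_max)), [set g (inr j) | j : 'I_t].
  split; rewrite ?inE ?subsetT //; first exact: reach_refl.
  split; rewrite ?(inj_eq inj_g) ?nbr_g //.
  + by rewrite card_imset ?card_ord // => i j /inj_g[].
  + by move=> _ /imsetP[j _ ->]; rewrite !nbr_g.
  + by move=> _ _ /imsetP[i _ ->] /imsetP[j _ ->]; rewrite (inj_eq inj_g) nbr_g orbF.
- apply: has_target_sub (subsetT (val @: [set: del_vertex v])) _.
  by apply: has_target_image (IH isoK) => [|x y]; [apply: val_inj | rewrite !nbrE].
- have uv' : u != v by apply: contraTneq uv => ->; rewrite adj_irrefl.
  apply: (has_target_piv (u := u) (v := v)); rewrite ?inE // ?nbrE ?uv ?orbT //.
  by rewrite -nbr_pivot //; apply: IH.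
Qed.

End Graphs.


Lemma card_leq_fibers (T I : finType) (Y : {set T}) (f : T -> I) (J : {set I}) m :
  (forall y, y \in Y -> f y \in J) ->
  (forall i, i \in J -> #|[set y in Y | f y == i]| <= m) -> #|Y| <= #|J| * m.
Proof.
move=> fJ leJ; rewrite -sum1_card (partition_big f (mem J)) //= -sum_nat_const.
apply: leq_sum => i /leJ; rewrite -sum1_card; apply: leq_trans.
by rewrite leq_eqVlt; apply/orP; left; apply/eqP; apply: eq_bigl => y; rewrite inE.
Qed.

(** * Counting the vertices outside a target *)

Section Counting.
Variables (V : finType) (N : nrel V) (t : nat).
Implicit Types (a b c v w x y z : V) (C : {set V}).

Hypothesis cN : closed_nbr N.
Hypothesis t_gt0 : 0 < t.
Hypothesis no_contraction : forall a b C v, good t N a b C ->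
  v != a -> v != b -> v \notin C ->
  (exists2 w, w != v & N v w) /\
  forall w, w != v -> N v w -> ~ has_target t [set~ v] (piv N v w).
(** With both flags true, [linked] says that [y] and [y'] are nonadjacent twins. *)
Hypothesis no_twins : forall a b C y y', good t N a b C ->
  y \notin a |: (b |: C) -> y' \notin a |: (b |: C) -> y != y' ->
  ~ linked N y y' true true.

Let rN := cN.1.
Let sN := cN.2.

Lemma goodC a b C : good t N a b C -> good t N b a C.
Proof.
move=> [/andP[ab Nab] leC abC CC]; split=> //; first by rewrite eq_sym ab sN.
by move=> c /abC[].
Qed.

(** The form in which minimality enters below: a target of the pivoted relation that misses [v]
    gives a contradiction. *)
Lemma good_no_contraction a b C v w a' b' C' : good t N a b C ->
  v \notin a |: (b |: C) -> w != v -> N v w ->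
  good t (piv N v w) a' b' C' -> v != a' -> v != b' -> v \in C'.
Proof.
move=> g; rewrite !inE !negb_or => /and3P[va vb vC] wv vw g' va' vb'.
have [_ /(_ w wv vw) P] := no_contraction g va vb vC.
by apply: contraT => vC'; case: P; apply: has_target_good g' _ _ _.
Qed.

Section Types.
Variables (a b : V) (C : {set V}).
Hypothesis g : good t N a b C.
Let T := a |: (b |: C).

Lemma good_ext (M : nrel V) :
  (forall p q, p \in T -> q \in T -> N p q = M p q) -> good t M a b C.
Proof.
have [/andP[ab Nab] leC abC CC] := g.
have aT : a \in T by rewrite !inE eqxx.
have bT : b \in T by rewrite !inE eqxx orbT.
have CT c : c \in C -> c \in T by rewrite !inE => ->; rewrite !orbT.
move=> NM; split=> //; first by rewrite ab -NM.
  by move=> c cC; have cT := CT c cC; rewrite -!NM //; apply: abC.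
by move=> c d cC dC cd; rewrite -NM ?CT //; apply: CC.
Qed.

(* Pivoting on [y w] does not change the graph on [T]. *)
Lemma type_neq y w : y \notin T -> w != y -> N y w ->
  ~ {in T, N y =1 N w}.
Proof.
move=> yT wy yw E; have g' : good t (piv N y w) a b C.
  by apply: good_ext => p q pT qT; rewrite pivE !E //; case: (N p q);
    case: (N w p); case: (N w q).
have yC := good_no_contraction g yT wy yw g'.
by move: yT; rewrite !inE !negb_or => /and3P[ya yb /negP[]]; apply: yC.
Qed.

(** Otherwise pivoting on any edge at [y] leaves the relation on [T] unchanged, and the old target
    survives without [y]. *)
Lemma type_neq0 y : y \notin T -> exists2 p, p \in T & N y p.
Proof.
move=> yT; have [/existsP[p /andP[pT yp]]|] := boolP [exists p, (p \in T) && N y p].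
  by exists p.
rewrite negb_exists => /forallP E.
have {}E p : p \in T -> N y p = false.
  by move=> pT; have := E p; rewrite pT; case: (N y p).
have := yT; rewrite !inE !negb_or => /and3P[ya yb yC].
have [[w wy yw] _] := no_contraction g ya yb yC.
have g' : good t (piv N y w) a b C.
  by apply: good_ext => p q pT qT; rewrite pivE !E //= !addbF.
by have := good_no_contraction g yT wy yw g' ya yb; rewrite (negPf yC).
Qed.

Lemma same_type_indep y y' : y \notin T -> y != y' ->
  {in T, N y =1 N y'} -> ~~ N y y'.
Proof.
move=> yT yy' E; apply/negP => Nyy'; apply: (type_neq yT _ Nyy') => //.
by rewrite eq_sym.
Qed.

(** Suppose [W] is larger and pivot on [y c] with [y] in [W]. As [c] is adjacent to all of [W], row
    [y] is added to every other row of [W] and cancels it at [a] and [b]; the edge [a b] stays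
    because [c] misses both ends. *)
Lemma card_type_leq c (W : {set V}) : c \in C ->
  (forall y, y \in W -> y \notin T /\ N y c) ->
  (forall y y', y \in W -> y' \in W -> {in T, N y =1 N y'}) -> #|W| <= t.
Proof.
move=> cC WT WW; rewrite leqNgt; apply/negP => ltW.
have [y yW] : exists y, y \in W by apply/card_gt0P; apply: leq_trans ltW.
have [yT yc] := WT _ yW.
have := yT; rewrite !inE !negb_or => /and3P[ya yb yC].
have [/andP[ab Nab] leC abC CC] := g; have [ac bc] := abC _ cC.
have cT : c \in T by rewrite !inE cC !orbT.
have aT : a \in T by rewrite !inE eqxx.
have bT : b \in T by rewrite !inE eqxx orbT.
have WW0 x x' : x \in W -> x' \in W -> x != x' -> N x x' = false.
  by move=> xW x'W xx'; apply/negbTE/same_type_indep => //; [case: (WT _ xW)|apply: WW].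
have cy : c != y by apply: contraNneq yC => <-.
have := @good_no_contraction a b C y c a b (W :\ y) g yT cy yc.
rewrite !inE eqxx /= => H; suff /H/(_ ya yb) : good t (piv N y c) a b (W :\ y) by [].
have Ca x : x \in W -> N c x by move=> xW; rewrite sN; case: (WT _ xW).
split.
- by rewrite ab pivE Nab !(sN c) (negPf ac) (negPf bc) !andbF.
- by rewrite (cardsD1 y) yW in ltW.
- move=> x; rewrite !inE => /andP[xy xW]; have yx : y != x by rewrite eq_sym.
  have E := WW x y xW yW; have yx0 : N y x = false by apply: WW0.
  by rewrite !pivE yx0 Ca // (sN a x) (sN b x) !E //; case: (N y a); case: (N y b).
- move=> x x'; rewrite !inE => /andP[xy xW] /andP[x'y x'W] xx'.
  by rewrite pivE WW0 // !(WW0 y) // eq_sym.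
Qed.

(** A type here consists of two bits, at [a] and [b], and a nonempty trace on [C]; each type has at
    most [t] vertices. *)
Lemma card_meet_leq :
  #|[set y | (y \notin T) && [exists c in C, N y c]]| <= 4 * (2 ^ #|C| - 1) * t.
Proof.
pose f y := ((N y a, N y b), [set c in C | N y c]).
have -> : 4 * (2 ^ #|C| - 1) = #|setX [set: bool * bool] (powerset C :\ set0)|.
  rewrite cardsX cardsT card_prod card_bool; have := cardsD1 set0 (powerset C).
  by rewrite card_powerset inE sub0set => ->; rewrite add1n subn1.
apply: (card_leq_fibers (f := f)) => [y|[ab S]].
  rewrite !inE => /andP[_ /existsP[c /andP[cC yc]]] /=; apply/andP; split.
    by apply/set0Pn; exists c; rewrite inE cC.
  by apply/subsetP=> d; rewrite inE => /andP[].
rewrite !inE /= => /andP[/set0Pn[c cS] /subsetP/(_ c cS) cC].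
apply: (card_type_leq cC) => [y|y y'].
  rewrite !inE => /andP[/andP[yT _] /eqP[_ E]]; rewrite yT.
  by split=> //; move: cS; rewrite -E inE => /andP[].
rewrite !inE => /andP[_ /eqP[Eab ES]] /andP[_ /eqP[Eab' ES']] p.
have [Ea Eb] : N y a = N y' a /\ N y b = N y' b by case: Eab Eab' => <- [-> ->].
rewrite !inE => /or3P[/eqP->|/eqP->|pC] //.
by have := ES'; rewrite -ES => /setP/(_ p); rewrite !inE pC.
Qed.

(** The class of type {a}. The class of type {b} is obtained by exchanging the ends of the edge, as
    in [goodC]. *)
Definition only_end : {set V} :=
  [set y | [&& y \notin T, N y a, ~~ N y b & ~~ [exists c in C, N y c]]].

(** Adding [b] to the class gives an independent set of neighbours of [a]. It is covered by [y0], by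
    fewer than [t] neighbours of [z] and by at most [t] nonneighbours, hence has at most [2 * t]
    elements, one of which is [b]. *)
Lemma card_only_end_leq : #|only_end| <= 2 * t - 1.
Proof.
have [/andP[ab Nab] leC abC CC] := g.
have WP y : y \in only_end ->
    [/\ y \notin T, N y a, N y b = false & forall c, c \in C -> N y c = false].
  rewrite in_set => /and4P[yT ya /negPf yb yC]; split=> // c cC.
  by apply: contraNF yC => yc; apply/existsP; exists c; rewrite cC.
have WT y : y \in only_end -> y \notin T by case/WP.
have Wb y : y \in b |: only_end -> N y a /\ y != a.
  case/setU1P=> [->|/WP[yT ya _ _]]; first by rewrite sN eq_sym.
  by split=> //; apply: contraNneq yT => ->; rewrite !inE eqxx.
have indep y y' : y \in b |: only_end -> y' \in b |: only_end -> y != y' -> ~~ N y y'.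
  move=> /setU1P[->|/WP[yT ya yb yC]] /setU1P[->|/WP[y'T y'a y'b y'C]] yy'.
  - by rewrite eqxx in yy'.
  - by rewrite sN y'b.
  - by rewrite yb.
  - apply: same_type_indep => // p; rewrite !inE.
    by case/or3P=> [/eqP->|/eqP->|pC]; rewrite ?ya ?y'a ?yb ?y'b ?yC ?y'C.
have bW : b \notin only_end by rewrite !inE eqxx orbT.
have [/existsP[y0 /andP[y0W /existsP[z /and3P[zy za y0z]]]]|none] :=
  boolP [exists y0 in only_end, exists z, [&& z != y0, z != a & N y0 z]]; last first.
  (* Here every member is pendant at [a], so two of them would be twins. *)
  have le1 : #|only_end| <= 1; last by apply: leq_trans le1 _; lia.
  rewrite leqNgt; apply/negP => /card_gt1P[y [y' [yW y'W yy']]].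
  apply: (no_twins g (WT _ yW) (WT _ y'W) yy') => p /=.
  have only x : x \in only_end -> N x p = (p == x) || (p == a).
    move=> xW; have [->|px] := eqVneq p x; first by rewrite rN.
    have [->|pa] := eqVneq p a; first by have [-> _] := Wb x (setU1r _ xW).
    apply: contraNF none => xp; apply/existsP; exists x; rewrite xW.
    by apply/existsP; exists p; rewrite px pa.
  rewrite !only //; have [->|pa] := eqVneq p a; last by rewrite !orbF.
  have [_ ya] := Wb y (setU1r _ yW); have [_ y'a] := Wb y' (setU1r _ y'W).
  by rewrite !(eq_sym a) (negPf ya) (negPf y'a).
have y0Wb := setU1r b y0W; have [y0a y0na] := Wb _ y0Wb.
have zW : z \notin b |: only_end.
  by apply/negP => /(indep _ _ y0Wb); rewrite eq_sym zy y0z => /(_ isT).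
set K := [set k in b |: only_end | (k != y0) && N z k].
set L := [set k in b |: only_end | ~~ N z k].
have az : a != z by rewrite eq_sym.
have ay0 : a != y0 by rewrite eq_sym.
have inWz k : k \in b |: only_end -> k != z by move=> kW; apply: contraNneq zW => <-.
(* Pivoting on [y0 a] detaches [K] from the edge [a z]. *)
have ltK : #|K| < t.
  rewrite ltnNge; apply/negP => leK.
  have := @good_no_contraction a b C y0 a a z K g (WT _ y0W) ay0 y0a.
  rewrite inE eqxx andbF => H; suff /H : good t (piv N y0 a) a z K.
    by rewrite (eq_sym y0 z) y0na zy => /(_ isT isT).
  have Ky0 k : k \in K -> [/\ k \in b |: only_end, N y0 k = false, N a k & N z k].
    rewrite inE => /and3P[kW ky0 zk]; split=> //; last by rewrite sN; case: (Wb _ kW).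
    by apply/negbTE/indep => //; rewrite eq_sym.
  split=> //.
  - by rewrite az pivE y0a rN y0z; case: (N a z).
  - move=> k /Ky0[kW y0k ak zk].
    by rewrite !pivE y0a y0z y0k ak zk.
  - move=> k k' /Ky0[kW y0k ak zk] /Ky0[k'W y0k' ak' zk'] kk'.
    by rewrite pivE y0k y0k' /= !addbF; apply: indep.
(* The edge [y0 z] with [L] is itself a target; contracting [y' \in L] into [a]
   preserves all of it except [y']. *)
have leL : #|L| <= t.
  rewrite leqNgt; apply/negP => ltL.
  (* [L] may contain [b], which belongs to [T], so a second element has to be available for
     contraction. *)
  have [y' y'L y'b] : exists2 y', y' \in L & y' != b.
    have /card_gt1P[x [x' [xL x'L xx']]] : 1 < #|L| by apply: leq_trans ltL.
    have [xb|] := eqVneq x b; last by exists x.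
    by exists x' => //; rewrite -xb eq_sym.
  have LP k : k \in L -> [/\ k \in b |: only_end, N k a, N z k = false, k != z & k != y0].
    rewrite inE => /andP[kW zk]; have [? _] := Wb _ kW.
    by split=> //; [apply/negbTE | exact: inWz | apply: contraNneq zk => ->; rewrite sN].
  have [y'Wb y'a zy' y'z y'y0] := LP _ y'L.
  have y'W : y' \in only_end by move: y'Wb; rewrite in_setU1 (negPf y'b).
  have ay' : a != y' by rewrite eq_sym; case: (Wb _ y'Wb).
  have := @good_no_contraction a b C y' a y0 z (L :\ y') g (WT _ y'W) ay' y'a.
  rewrite !inE eqxx /= => H; suff /H : good t (piv N y' a) y0 z (L :\ y').
    by rewrite y'y0 y'z => /(_ isT isT).
  have y'0 k : k \in b |: only_end -> k != y' -> N y' k = false.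
    by move=> kW ky'; apply/negbTE/indep => //; rewrite eq_sym.
  have y'y00 : N y' y0 = false by apply: y'0; rewrite // eq_sym.
  have LN k k' : N y' k = false -> N y' k' = false -> piv N y' a k k' = N k k'.
    by move=> e e'; rewrite pivE e e' /= !addbF.
  have y'z0 : N y' z = false by rewrite sN.
  split.
  - by rewrite eq_sym zy LN.
  - by rewrite (cardsD1 y') y'L in ltL.
  - move=> k; rewrite in_setD1 => /andP[ky' /LP[kW ka zk kz ky0]].
    have y'k := y'0 _ kW ky'; rewrite !LN //; split; last by rewrite zk.
    by apply: indep; rewrite // eq_sym.
  - move=> k k'; rewrite !in_setD1 => /andP[ky' /LP[kW _ _ _ _]] /andP[k'y' /LP[k'W _ _ _ _]] kk'.
    by rewrite LN ?y'0 //; apply: indep.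
have cW : #|b |: only_end| = #|only_end|.+1 by rewrite cardsU1 bW.
have : #|b |: only_end| <= #|[set y0] :|: (K :|: L)|.
  apply/subset_leq_card/subsetP => k kW; rewrite 2!in_setU in_set1 [k \in K]in_set [k \in L]in_set kW.
  by case: (k == y0) => //=; case: (N z k).
have := cardsU [set y0] (K :|: L); have := cardsU K L; rewrite cards1; lia.
Qed.

End Types.

(** The summands count the target, the classes meeting its isolated vertices, and the two classes
    {a} and {b}. [C] is first cut down to a set [D] of exactly [t] vertices, so that it has only
    [2 ^ t] subsets. *)
Lemma card_vertices_leq a b C : good t N a b C ->
  #|V| <= t + 2 + 4 * (2 ^ t - 1) * t + (4 * t - 2).
Proof.
move=> [abN leC abC CC]; have [D DC cD] : exists2 D : {set V}, D \subset C & #|D| = t.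
  exists [set x in take t (enum C)].
    by apply/subsetP=> x; rewrite inE => /mem_take; rewrite mem_enum.
  rewrite cardsE; have /card_uniqP -> : uniq (take t (enum C)).
    by rewrite take_uniq ?enum_uniq.
  by rewrite size_take_min -cardE; apply/minn_idPl.
have /subsetP sDC := DC.
have g : good t N a b D.
  split=> [//||c /sDC|c d /sDC cC /sDC dC]; [by rewrite cD | exact: abC | exact: CC].
have g' := goodC g.
pose T := a |: (b |: D).
have cT : #|T| <= t + 2 by rewrite !cardsU1 cD; lia.
pose Y := [set y | (y \notin T) && [exists c in D, N y c]].
have := card_meet_leq g; rewrite cD -/T -/Y => cY.
have := card_only_end_leq g; have := card_only_end_leq g'.
set A := only_end _ _ _; set B := only_end _ _ _ => cA cB.
suff : #|[set: V]| <= #|T :|: (Y :|: (A :|: B))|.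
  rewrite cardsT; have := cardsU T (Y :|: (A :|: B)); have := cardsU Y (A :|: B).
  have := cardsU A B; lia.
apply/subset_leq_card/subsetP => y _; rewrite 3!in_setU.
have [//|yT] := boolP (y \in T).
rewrite [y \in Y]in_set [y \in A]in_set [y \in B]in_set (setUCA [set b]) -/T yT /=.
have [//|yC] := boolP [exists c in D, N y c]; rewrite !andbT /=.
have [p pT yp] := type_neq0 g yT.
have no_p : p \notin D.
  by apply: contraNN yC => pD; apply/existsP; exists p; rewrite pD.
have : N y a || N y b.
  by move: pT yp; rewrite !inE (negPf no_p) orbF => /orP[/eqP->|/eqP->] ->; rewrite ?orbT.
have [ya|] := boolP (N y a); have [yb|] := boolP (N y b) => //=.
have ay : a != y by apply: contraNneq yT => <-; rewrite !inE eqxx.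
(* Type {a, b} is excluded because [y] would agree on the target with its neighbour [a]. *)
case: (type_neq g yT ay ya) => q.
rewrite !inE => /or3P[/eqP->|/eqP->|qD].
- by rewrite ya rN.
- by case/andP: abN => _ ->; rewrite yb.
- have [/negPf -> _] := abC _ (sDC _ qD); apply: contraNF yC => yq.
  by apply/existsP; exists q; rewrite qD.
Qed.

End Counting.

Theorem theorem4p9 (t : nat) (G : sgraph) (ht : 0 < t)
    (hG : minimal_with_pivot_minor G (P2_tP1 t)) :
  #|vert G| <= (t + 1) * (2 ^ (t + 2) - t - 2).
Proof.
have [/pivot_minor_has_target[M [a [b [C [r g _ _ _]]]]] minG] := hG.
have cG := closed_nbr_nbr G; have cM := closed_nbr_reach cG r.
have [s [sP sL]] := reach_states t cG r.
have no_target v : ~ has_target t [set~ v] (nbr G).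
  move=> /has_target_pivot_minor; apply: minG; rewrite properT.
  by apply/eqP => /setP/(_ v); rewrite !inE eqxx.
(* If [s v] were true, a target of [M] avoiding [v] would pull back to [G] without [v], against
   minimality. *)
have s0 a' b' C' v : good t M a' b' C' -> v != a' -> v != b' -> v \notin C' ->
    s v = false.
  move=> g' va vb vC; apply/negP => sv; have := sP v; rewrite sv => P.
  by apply: (no_target v); apply/P/(has_target_good g').
have := @card_vertices_leq _ M t cM ht _ _ a b C g.
have le : t + 2 + 4 * (2 ^ t - 1) * t + (4 * t - 2) <= (t + 1) * (2 ^ (t + 2) - t - 2).
  (* The left side equals [4 * t * 2 ^ t + t], so the claim amounts to this inequality, which holds
     from [t = 1] on by induction. *)
  rewrite expnD; have : t * t + 4 * t + 2 <= 2 ^ t * 2 ^ 2.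
    elim: t ht {sP sL no_target s0 hG g minG r s} => // -[//|n] IH _.
    have := IH isT; rewrite (expnS 2 n.+1); set p := 2 ^ n.+1; rewrite -[2 ^ 2]/4; nia.
  have : 0 < 2 ^ t by rewrite expn_gt0.
  set p := 2 ^ t; rewrite -[2 ^ 2]/4; nia.
move=> H; apply: leq_trans le; apply: H.
- move=> a' b' C' v g' va vb vC; have := sP v; rewrite (s0 _ _ _ _ g' va vb vC).
  by case=> nv P; split=> // w wv vw /(P w wv vw); apply: no_target.
- move=> a' b' C' y y' g'; rewrite !inE !negb_or => /and3P[ya yb yC] /and3P[y'a y'b y'C] yy'.
  by have := sL y y' yy'; rewrite (s0 _ _ _ _ g' ya yb yC) (s0 _ _ _ _ g' y'a y'b y'C).
Qed.
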